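(* For every odd $n\ge13$, every crossing optimal 2-page book drawing of $K_n$ (normalized as in the context) has exactly one Hamiltonian cycle consisting of non-crossed edges, namely the cycle $1,2,\dots,n,1$ formed by the spine edges $12,23,\dots,(n-1)n$ and the edge $1n$.
   Context: Normalized 2-page book drawings of $K_n$: vertices $(1,0),\dots,(n,0)$ labelled $1,\dots,n$ left to right; edges $i(i+1)$ drawn on the $x$-axis; edge $1n$ in the upper half-plane; every other edge $ij$ a semicircle over $[i,j]$ in the upper or lower half-plane. A drawing is crossing optimal if it has exactly $Z(n)=\frac14\lfloor\frac n2\rfloor\lfloor\frac{n-1}2\rfloor\lfloor\frac{n-2}2\rfloor\lfloor\frac{n-3}2\rfloor$ crossings. An edge is non-crossed if no other edge crosses it. *)

(* Defs.v *)
From mathcomp Require Import all_boot.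
Set Implicit Arguments. Unset Strict Implicit. Unset Printing Implicit Defensive.

(* Vertices of K_n are 'I_n; vertex i : 'I_n stands for the paper's label i+1,
   placed at (i+1, 0) on the spine.  An edge is represented by the ordered pair
   (a, b) with a < b.  A normalized 2-page book drawing is determined by the
   page assignment [page a b] (true = upper half-plane, false = lower) of every
   edge ab with a < b; the value is irrelevant for spine edges a(a+1), which are
   drawn on the x-axis (they can never interleave with another edge). *)

Definition book_drawing (n : nat) := 'I_n -> 'I_n -> bool.

Definition normalized n (page : book_drawing n) : Prop :=
  forall (a b : 'I_n), val a = 0 -> val b = n.-1 -> page a b = true.

Definition crosses n (page : book_drawing n) (a b c d : 'I_n) : bool :=
  [&& a < b, c < d, page a b == page c d &
      ((a < c) && (c < b) && (b < d)) || ((c < a) && (a < d) && (d < b))].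

(* number of crossings: each crossing pair {ab, cd} counted once, with a < c *)
Definition crossing_number n (page : book_drawing n) : nat :=
  #|[set x : 'I_n * 'I_n * 'I_n * 'I_n |
      [&& x.1.1.1 < x.1.1.2, x.1.1.2 < x.1.2, x.1.2 < x.2 &
          page x.1.1.1 x.1.2 == page x.1.1.2 x.2]]|.

Definition Z (n : nat) : nat :=
  (half n * half (n - 1) * half (n - 2) * half (n - 3)) %/ 4.

Definition crossing_optimal n (page : book_drawing n) : Prop :=
  crossing_number page = Z n.

Definition edge_of n (u v : 'I_n) : 'I_n * 'I_n :=
  if u < v then (u, v) else (v, u).

Definition non_crossed n (page : book_drawing n) (e : 'I_n * 'I_n) : bool :=
  [forall c : 'I_n, forall d : 'I_n, ~~ crosses page e.1 e.2 c d].

Definition cycle_edges n (s : seq 'I_n) : {set 'I_n * 'I_n} :=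
  [set e | [exists i : 'I_(size s),
      e == edge_of (tnth (in_tuple s) i)
                   (tnth (in_tuple s) (Ordinal (ltn_pmod i.+1 (leq_ltn_trans (leq0n i) (ltn_ord i)))))]].

Definition std_cycle_edges n : {set 'I_n * 'I_n} :=
  [set e : 'I_n * 'I_n | (e.1 < e.2) && ((val e.2 == (val e.1).+1) || ((val e.1 == 0) && (val e.2 == n.-1)))].

Definition noncrossed_ham_cycle n (page : book_drawing n) (s : seq 'I_n) : Prop :=
  [/\ uniq s, size s = n &
      forall e, e \in cycle_edges s -> non_crossed page e].

(* Main.v *)
Require Import Defs.
From mathcomp Require Import all_boot zify.
Set Implicit Arguments. Unset Strict Implicit. Unset Printing Implicit Defensive.

(** An edge ab together with the orientation of the triangles abk splits the
    other vertices into a left and a right part.  Summing left * right over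
    all edges gives 3 C(n,4) minus the number of crossings, so for n = 2m+1 the
    crossings are an affine function, with positive coefficients, of the sums
    W_k = sum_(edges) (k - left)^+ + (k - right)^+ for k < m.  Deleting the last
    vertex s shows W_k >= 3 C(k+2,3): vertex number a (from 0) has at least
    k+1-a edges to its right with at most k vertices on the side away from s.
    In an optimal drawing these bounds are all equalities, for every rotation
    of the spine.

    Suppose a non-crossed chord has at least two vertices on each side; all
    edges joining the two sides lie on one page.  Rotating so that the chord
    starts at vertex 1, vertex 2 then violates the equalities for k = 1, 2.
    Hence a non-crossed chord cuts off a single vertex, whose edges are all on
    the same page.  Two such chords cannot cross: this would make two
    consecutive vertices 1, 2 monochromatic of opposite colours, and each forces
    the edge 03 to the page opposite to its own.  A Hamiltonian cycle of
    non-crossed edges containing such a chord would contain a second one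
    crossing it, or a triangle. *)

(** * Sums over increasing tuples *)

Definition sum2 n (F : nat -> nat -> nat) := \sum_(b < n) \sum_(a < b) F a b.
Definition sum3 n (F : nat -> nat -> nat -> nat) :=
  \sum_(c < n) sum2 c (fun a b => F a b c).
Definition sum4 n (F : nat -> nat -> nat -> nat -> nat) :=
  \sum_(d < n) sum3 d (fun a b c => F a b c d).

Lemma sum2S n F : sum2 n.+1 F = sum2 n F + \sum_(a < n) F a n.
Proof. by rewrite /sum2 big_ord_recr. Qed.

Lemma sum3S n F : sum3 n.+1 F = sum3 n F + sum2 n (fun a b => F a b n).
Proof. by rewrite /sum3 big_ord_recr. Qed.

Lemma sum4S n F : sum4 n.+1 F = sum4 n F + sum3 n (fun a b c => F a b c n).
Proof. by rewrite /sum4 big_ord_recr. Qed.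

Lemma eq_sum2 n F G : (forall a b, a < b -> b < n -> F a b = G a b) ->
  sum2 n F = sum2 n G.
Proof.
move=> FG; apply: eq_bigr => b _; apply: eq_bigr => a _.
exact: FG (ltn_ord a) (ltn_ord b).
Qed.

Lemma eq_sum3 n F G :
  (forall a b c, a < b -> b < c -> c < n -> F a b c = G a b c) ->
  sum3 n F = sum3 n G.
Proof.
move=> FG; apply: eq_bigr => c _; apply: eq_sum2 => a b ab bc.
exact: FG ab bc (ltn_ord c).
Qed.

Lemma eq_sum4 n F G :
  (forall a b c d, a < b -> b < c -> c < d -> d < n -> F a b c d = G a b c d) ->
  sum4 n F = sum4 n G.
Proof.
move=> FG; apply: eq_bigr => d _; apply: eq_sum3 => a b c ab bc cd.
exact: FG ab bc cd (ltn_ord d).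
Qed.

Lemma sum2_shift n F :
  sum2 n.+1 F = \sum_(b < n) F 0 b.+1 + sum2 n (fun a b => F a.+1 b.+1).
Proof.
rewrite /sum2 big_ord_recl big_ord0 add0n -big_split /=.
by apply: eq_bigr => b _; rewrite big_ord_recl.
Qed.

Lemma sum3_shift n F :
  sum3 n.+1 F = sum2 n (fun b c => F 0 b.+1 c.+1) +
                sum3 n (fun a b c => F a.+1 b.+1 c.+1).
Proof.
rewrite /sum3 big_ord_recl [X in X + _ = _]big_ord0 add0n.
rewrite [X in _ = X + _]/sum2 -big_split /=.
by apply: eq_bigr => c _; rewrite sum2_shift.
Qed.

Lemma sum4_shift n F :
  sum4 n.+1 F = sum3 n (fun b c d => F 0 b.+1 c.+1 d.+1) +
                sum4 n (fun a b c d => F a.+1 b.+1 c.+1 d.+1).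
Proof.
rewrite /sum4 big_ord_recl [X in X + _ = _]big_ord0 add0n.
rewrite [X in _ = X + _]/sum3 -big_split /=.
by apply: eq_bigr => d _; rewrite sum3_shift.
Qed.

Lemma sum2D n F G : sum2 n (fun a b => F a b + G a b) = sum2 n F + sum2 n G.
Proof.
by rewrite /sum2 -big_split; apply: eq_bigr => b _; rewrite -big_split.
Qed.

Lemma sum3D n F G :
  sum3 n (fun a b c => F a b c + G a b c) = sum3 n F + sum3 n G.
Proof.
by rewrite /sum3 -big_split; apply: eq_bigr => c _ /=; rewrite -sum2D.
Qed.

Lemma sum2_const n k : sum2 n (fun _ _ => k) = 'C(n, 2) * k.
Proof.
elim: n => [|n IHn]; first by rewrite /sum2 big_ord0.
by rewrite sum2S IHn sum_nat_const card_ord binS bin1 mulnDl.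
Qed.

Lemma sum3_1 n : sum3 n (fun _ _ _ => 1) = 'C(n, 3).
Proof.
elim: n => [|n IHn]; first by rewrite /sum3 big_ord0.
by rewrite sum3S IHn sum2_const muln1 binS.
Qed.

Lemma sum2_rows n F : sum2 n F = \sum_(a < n) \sum_(a.+1 <= b < n) F a b.
Proof.
elim: n => [|n IHn]; first by rewrite /sum2 !big_ord0.
rewrite sum2S IHn big_ord_recr /= (big_geq (leqnn _)) addn0 -big_split /=.
by apply: eq_bigr => a _; rewrite big_nat_recr.
Qed.

Lemma sum2_fst n h : sum2 n (fun a _ => h a) = \sum_(a < n) (n.-1 - a) * h a.
Proof.
rewrite sum2_rows; apply: eq_bigr => a _.
by rewrite sum_nat_const_nat; congr (_ * _); lia.
Qed.

(* Both sides count the triples a < b < c with weight [g a c]. *)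
Lemma sum2_outer n g :
  sum2 n (fun a b => \sum_(b.+1 <= c < n) g a c) =
  sum2 n (fun a c => (c - a.+1) * g a c).
Proof.
elim: n => [|n IHn]; first by rewrite /sum2 !big_ord0.
rewrite !sum2S -IHn [X in _ + X = _]big1 => [|a _]; last by rewrite big_geq.
rewrite addn0 [X in _ = _ + X](eq_bigr (fun a : 'I_n => (n.-1 - a) * g a n));
  last by move=> a _; congr (_ * _); lia.
rewrite -(sum2_fst n (fun a => g a n)) -sum2D; apply: eq_sum2 => a b _ bn.
by rewrite big_nat_recr.
Qed.

Lemma sum2_gap n : sum2 n (fun a b => b - a.+1) = 'C(n, 3).
Proof.
have -> : sum2 n (fun a b => b - a.+1) = sum3 n (fun _ _ _ => 1).
  rewrite /sum3; apply: eq_bigr => c _; rewrite (sum2_fst c (fun _ => 1)).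
  by apply: eq_bigr => a _; lia.
exact: sum3_1.
Qed.

(** * Sides of an edge *)

(* A triangle x < y < z is oriented by the page of its longest edge xz; hence k
   lies on side c of ab according to the page of ak if k > b, of kb if k < a,
   and of ab itself (reversed) if a < k < b. *)
Definition side (c : bool) (u : nat -> nat -> bool) s a b :=
  \sum_(b.+1 <= k < s) (u a k == c) + \sum_(k < a) (u k b == c)
  + (b - a.+1) * (u a b != c).

Definition crossings n (u : nat -> nat -> bool) :=
  sum4 n (fun a b c d => u a c == u b d).

Lemma sideS c u s a b : b < s ->
  side c u s.+1 a b = side c u s a b + (u a s == c).
Proof. by move=> bs; rewrite /side big_nat_recr //=; lia. Qed.

Lemma side_last c u s a :
  side c u s.+1 a s = \sum_(k < a) (u k s == c) + (s.-1 - a) * (u a s != c).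
Proof. by rewrite /side big_geq //; congr (_ + _ * _); lia. Qed.

Lemma side_compl c u s a b : a < b -> b < s ->
  (side c u s a b + side (~~ c) u s a b).+2 = s.
Proof.
move=> ab bs; rewrite /side.
have E (x : bool) : (x == c) + (x == ~~ c) = 1 by case: x; case: c.
have H1 : \sum_(k < a) (u k b == c) + \sum_(k < a) (u k b == ~~ c) = a.
  rewrite -big_split /= (eq_bigr (fun=> 1)) => [|k _]; last exact: E.
  by rewrite sum_nat_const card_ord muln1.
have H2 : \sum_(b.+1 <= k < s) (u a k == c) +
          \sum_(b.+1 <= k < s) (u a k == ~~ c) = s - b.+1.
  rewrite -big_split /= (eq_bigr (fun=> 1)) => [|k _]; last exact: E.
  by rewrite sum_nat_const_nat muln1.
have H3 : (u a b != c) + (u a b != ~~ c) = 1 by case: (u a b); case: (c).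
have H4 : (b - a.+1) * (u a b != c) + (b - a.+1) * (u a b != ~~ c) = b - a.+1.
  by rewrite -mulnDr H3 muln1.
lia.
Qed.

(* The edges at an extreme vertex have every possible number of vertices on
   a given side, each exactly once. *)
Lemma sum_extreme M (w : nat -> bool) (g : nat -> nat) :
  \sum_(a < M) g (\sum_(k < a) w k + (M.-1 - a) * ~~ w a) = \sum_(j < M) g j.
Proof.
elim: M w g => [|M IHM] w g; first by rewrite !big_ord0.
rewrite big_ord_recl big_ord0 /= subn0 add0n.
case w0: (w 0) => /=.
  rewrite muln0 [RHS]big_ord_recl; congr (_ + _).
  rewrite -(IHM (w \o succn) (g \o succn)); apply: eq_bigr => a _ /=.
  rewrite big_ord_recl w0 /= -addnA; congr (g (_ + (_ + _ * _))).
  by rewrite /bump /=; have := ltn_ord a; lia.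
rewrite muln1 [RHS]big_ord_recr /= addnC; congr (_ + _).
rewrite -(IHM (w \o succn) g); apply: eq_bigr => a _ /=.
rewrite big_ord_recl w0 /= add0n; congr (g (_ + _ * _)).
by rewrite /bump /=; have := ltn_ord a; lia.
Qed.

(** Induction on the last vertex: if [w s] holds, the edge to [s] has value 0 and all other values
    rise by one; otherwise it has the largest value and the others do not change. *)
Lemma sum_row a s (w : nat -> bool) (g : nat -> nat) :
  \sum_(a.+1 <= b < s) g (\sum_(b.+1 <= k < s) w k + (b - a.+1) * ~~ w b) =
  \sum_(j < s - a.+1) g j.
Proof.
elim: s g => [|s IHs] g; first by rewrite big_geq // big_ord0.
have [sa|sa] := leqP s a; first by rewrite big_geq // subnE big1 //; case=> j /=; lia.
rewrite big_nat_recr //= (big_geq (leqnn _)) add0n.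
have -> : s.+1 - a.+1 = (s - a.+1).+1 by lia.
case ws: (w s) => /=.
  rewrite muln0 [RHS]big_ord_recl addnC; congr (_ + _).
  rewrite -(IHs (g \o succn)) big_nat_cond [RHS]big_nat_cond.
  apply: eq_bigr => b /andP[/andP[_ bs] _] /=.
  by rewrite big_nat_recr //= ws; congr g; lia.
rewrite muln1 [RHS]big_ord_recr /=; congr (_ + _).
rewrite -IHs big_nat_cond [RHS]big_nat_cond.
apply: eq_bigr => b /andP[/andP[_ bs] _] /=.
by rewrite big_nat_recr //= ws; congr g; lia.
Qed.

Lemma sum_last_side c u s (g : nat -> nat) :
  \sum_(a < s) g (side c u s.+1 a s) = \sum_(j < s) g j.
Proof.
rewrite -(sum_extreme s (fun k => u k s == c)).
by apply: eq_bigr => a _; rewrite side_last.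
Qed.

Lemma sum_gauss n : \sum_(j < n) (n.-1 - j) = 'C(n, 2).
Proof.
case: n => [|n]; first by rewrite big_ord0.
by rewrite -bin2_sum big_mkord (reindex_inj rev_ord_inj) /=;
   apply: eq_bigr => i _; have := ltn_ord i; lia.
Qed.

Lemma sum_truncB k s : k <= s -> \sum_(j < s) (k - j) = 'C(k.+1, 2).
Proof.
move=> ks; rewrite -sum_gauss -(subnKC ks) big_split_ord /= addnC big1; last first.
  by move=> i _; lia.
by rewrite big_ord_recr /= subnn addn0.
Qed.

Lemma sum_mul_compl s : \sum_(j < s) j * (s.-1 - j) = 'C(s, 3).
Proof.
rewrite -sum3_1 /sum3.
transitivity (sum2 s (fun a _ => a)).
  by rewrite sum2_fst; apply: eq_bigr => j _; rewrite mulnC.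
apply: eq_bigr => c _; apply: eq_bigr => b _.
by rewrite sum_nat_const card_ord muln1.
Qed.

(** * Crossings and edge weights *)

(* [opp u s a b] is the number of vertices on the side of ab that does not
   contain the additional last vertex s. *)
Definition opp (u : nat -> nat -> bool) s a b := side (~~ u a s) u s a b.

(** The triple sum counts the crossings on edges at the added vertex [s]. In [opp], the vertices
    after [b] and those between [a] and [b] together yield every triple once, by [sum2_outer]; the
    vertices before [a] yield exactly the triples that the triple sum misses. *)
Lemma sum_opp u s :
  sum2 s (opp u s) + sum3 s (fun x y z => u x z == u y s) = 2 * 'C(s, 3).
Proof.
have N (x y : bool) : (x == ~~ y) + (x == y) = 1 by case: x; case: y.
rewrite (eq_sum2 (G := fun a b => (\sum_(b.+1 <= k < s) (u a k == ~~ u a s)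
    + (b - a.+1) * (u a b == u a s)) + \sum_(k < a) (u k b == ~~ u a s)));
  last first.
  move=> a b _ _; rewrite /opp /side.
  have -> : (u a b != ~~ u a s) = (u a b == u a s).
    by case: (u a b); case: (u a s).
  by rewrite addnAC.
rewrite !sum2D (sum2_outer s (fun a k => u a k == ~~ u a s)) -sum2D.
rewrite (eq_sum2 (G := fun a b => b - a.+1)); last first.
  by move=> a b _ _; rewrite -mulnDr N muln1.
rewrite sum2_gap -addnA mul2n -addnn; congr (_ + _); rewrite -sum3_1.
rewrite (_ : sum2 s _ = sum3 s (fun x y z => u x z == ~~ u y s)) // -sum3D.
by apply: eq_sum3 => x y z _ _ _; rewrite N.
Qed.

(** Adding the vertex [s] enlarges the side of ab that contains it, so left times right grows by
    [opp]. The left sizes of the edges at [s] are 0, ..., s-1, each once, which gives ['C(s, 3)];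
    [sum_opp] supplies the other [2 * 'C(s, 3)]. *)
Lemma crossings_sides u s :
  sum2 s (fun a b => side true u s a b * side false u s a b) + crossings s u =
  3 * 'C(s, 4).
Proof.
elim: s => [|s IHs]; first by rewrite /sum2 /crossings /sum4 !big_ord0.
rewrite /crossings sum2S sum4S -/(crossings s u) binS.
rewrite (eq_sum2 (G := fun a b => side true u s a b * side false u s a b
   + opp u s a b)); last first.
  move=> a b _ bs; rewrite !sideS // /opp.
  by case: (u a s) => /=; nia.
have -> : \sum_(a < s) side true u s.+1 a s * side false u s.+1 a s = 'C(s, 3).
  rewrite -sum_mul_compl -(sum_last_side true u s (fun j => j * (s.-1 - j))).
  apply: eq_bigr => a _; have := side_compl true u (ltn_ord a) (ltnSn s).
  by move=> E; congr (_ * _); move: E => /=; lia.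
rewrite sum2D; have := sum_opp u s; lia.
Qed.

(* For 2k < s this is the number of (<=<=(k-1))-edges of Abrego et al. *)
Definition weight u s k :=
  sum2 s (fun a b => (k - side true u s a b) + (k - side false u s a b)).

Definition low_row u s k a := \sum_(a.+1 <= b < s) (opp u s a b <= k).

(** On the side containing [s], growth by one cancels the step from [k] to [k.+1]; the opposite side
    gains one exactly when [opp] is at most [k]. The edges at [s] contribute ['C(k.+2, 2)] for each
    of the two sides. *)
Lemma weightS u s k : k < s ->
  weight u s.+1 k.+1 =
  weight u s k + \sum_(a < s) low_row u s k a + 2 * 'C(k.+2, 2).
Proof.
move=> ks; rewrite /weight sum2S big_split /=.
rewrite (sum_last_side true u s (fun j => k.+1 - j)).
rewrite (sum_last_side false u s (fun j => k.+1 - j)) !sum_truncB //.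
rewrite addnn -mul2n; congr (_ + _).
rewrite -(sum2_rows s (fun a b => opp u s a b <= k)) -sum2D.
apply: eq_sum2 => a b _ bs; rewrite !sideS // /opp.
by case: (u a s) => /=; lia.
Qed.

(** Ignoring the vertices before [a], the edges from [a] to the right take each value once, so
    [k.+1 - a] of them have value at most [k - a]. The [a] ignored vertices add at most [a]. *)
Lemma low_row_ge u s k a : k.+1 < s -> k.+1 - a <= low_row u s k a.
Proof.
move=> ks; have [ka|ak] := ltnP k a; first by have -> : k.+1 - a = 0 by lia.
pose w b := u a b == ~~ u a s.
have <- : \sum_(a.+1 <= b < s)
   ((\sum_(b.+1 <= j < s) w j + (b - a.+1) * ~~ w b) <= k - a) = k.+1 - a.
  rewrite (sum_row a s w (fun j => j <= k - a)).
  rewrite (_ : s - a.+1 = (k.+1 - a) + (s - k.+2)); last lia.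
  rewrite big_split_ord /= (eq_bigr (fun=> 1)); last first.
    by move=> i _; have := ltn_ord i; case: leqP => //=; lia.
  rewrite sum_nat_const card_ord muln1 big1 ?addn0 // => i _.
  by case: leqP => //=; lia.
rewrite /low_row; apply: leq_sum => b _; rewrite /opp /side /w.
have H : \sum_(j < a) (u j b == ~~ u a s) <= a.
  apply: (@leq_trans (\sum_(j < a) 1)); first by apply: leq_sum => j _; case: eqP.
  by rewrite sum_nat_const card_ord muln1.
move: (\sum_(b.+1 <= _ < s) _) ((b - a.+1) * _) (\sum_(_ < a) _) H; lia.
Qed.

Lemma sum_low_row_ge u s k : k.+1 < s ->
  'C(k.+2, 2) <= \sum_(a < s) low_row u s k a.
Proof.
move=> ks; rewrite -(@sum_truncB k.+1 s); last lia.
by apply: leq_sum => a _; exact: low_row_ge.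
Qed.

Lemma weight_ge u s k : k.+1 < s -> 3 * 'C(k.+2, 3) <= weight u s k.
Proof.
elim: s k => [|s IHs] [|k] //= ks; rewrite weightS; last lia.
have := IHs k; have := @sum_low_row_ge u s k; rewrite (binS k.+2 2); lia.
Qed.

Lemma sum_hockey m : \sum_(k < m) 'C(k.+2, 3) = 'C(m.+2, 4).
Proof.
elim: m => [|m IHm]; first by rewrite big_ord0.
by rewrite big_ord_recr /= IHm [RHS]binS.
Qed.

Lemma sum_trunc_subB m l : \sum_(k < m) (k - l) = 'C(m - l, 2).
Proof.
elim: m => [|m IHm]; first by rewrite big_ord0.
rewrite big_ord_recr /= IHm; have [lm|ml] := leqP l m.
  by rewrite subSn // binS bin1.
have -> : m - l = 0 by lia.
by have -> : m.+1 - l = 0 by lia.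
Qed.

Lemma bin2E p : 2 * 'C(p.+1, 2) = p.+1 * p.
Proof. by have := mul_bin_left p.+1 1; rewrite bin1; lia. Qed.

(** Sides with L + R = 2m-1 satisfy LR + 2 C(m-L, 2) + 2 C(m-R, 2) = m(m-1), and the binomials come
    from summing the truncated differences over [k < m]. *)
Lemma crossings_weight u m :
  crossings m.*2.+1 u + 'C(m.*2.+1, 2) * (m * m.-1) =
  3 * 'C(m.*2.+1, 4) + 2 * \sum_(k < m) weight u m.*2.+1 k.
Proof.
rewrite -(crossings_sides u) -sum2_const [RHS]addnAC [LHS]addnC.
congr (_ + _); apply: esym.
have -> : \sum_(k < m) weight u m.*2.+1 k =
    sum2 m.*2.+1 (fun a b => \sum_(k < m) ((k - side true u m.*2.+1 a b)
      + (k - side false u m.*2.+1 a b))).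
  rewrite exchange_big; apply: eq_bigr => b _.
  by rewrite exchange_big.
rewrite [2 * _]mulSn mul1n -!sum2D; apply: eq_sum2 => a b ab bs.
have := side_compl true u ab bs; rewrite /=.
move: (side true _ _ _ _) (side false _ _ _ _) => L R E.
rewrite big_split /= !sum_trunc_subB.
wlog LR : L R E / L < R => [H|].
  have [|RL] := ltnP L R; first exact: H.
  by have := H R L; lia.
have -> : m - R = 0 by lia.
rewrite bin0n addn0.
case: m E bs => [|m] E bs; first lia.
have -> : m.+1 - L = (m - L).+1 by lia.
have := bin2E (m - L); have -> : R = (m - L) + m.+1 by lia.
have : L <= m by lia.
move: ('C(_, 2)) => B; nia.
Qed.

Lemma Z_odd m : Z m.*2.+1 = 'C(m, 2) ^ 2.
Proof.
case: m => [|m] //; rewrite /Z.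
rewrite (_ : m.+1.*2.+1./2 = m.+1); last lia.
rewrite (_ : (m.+1.*2.+1 - 1)./2 = m.+1); last lia.
rewrite (_ : (m.+1.*2.+1 - 2)./2 = m); last lia.
rewrite (_ : (m.+1.*2.+1 - 3)./2 = m); last lia.
rewrite (_ : _ * _ * m * m = 'C(m.+1, 2) ^ 2 * 4) ?mulnK //.
have := bin2E m; move: ('C(_, 2)) => B; nia.
Qed.

Lemma bin4E p : 24 * 'C(p.+3, 4) = p.+3 * p.+2 * p.+1 * p.
Proof.
have := mul_bin_left p.+3 3; have := mul_bin_left p.+3 2.
have := mul_bin_left p.+3 1; rewrite bin1.
have -> : p.+3 - 3 = p by lia.
have -> : p.+3 - 2 = p.+1 by lia.
have -> : p.+3 - 1 = p.+2 by lia.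
move=> E1 E2 E3.
have {}E1 : 2 * 'C(p.+3, 2) * (p.+1 * p) = p.+2 * p.+3 * (p.+1 * p) by rewrite E1.
have {}E2 : 3 * 'C(p.+3, 3) * p = p.+1 * 'C(p.+3, 2) * p by rewrite E2.
lia.
Qed.

(** [Z] is the crossing count for which the bounds of [weight_ge] with [k < m] are all
    equalities. *)
Lemma optimal_weight_value m :
  Z m.*2.+1 + 'C(m.*2.+1, 2) * (m * m.-1) =
  3 * 'C(m.*2.+1, 4) + 2 * (3 * 'C(m.+2, 4)).
Proof.
case: m => [|m] //; rewrite Z_odd.
have A := bin2E m; have B := bin2E m.+1.*2.
have C := bin4E m; have D := bin4E m.*2.
rewrite (_ : m.+1.*2.+1 = m.*2.+3) in B *; last lia.
move: ('C(m.+1, 2)) ('C(m.*2.+3, 2)) ('C(m.*2.+3, 4)) ('C(m.+3, 4)) A B C D.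
move=> a b c d A B C D; rewrite /=.
have {}A : (2 * a) * (2 * a) = (m.+1 * m) * (m.+1 * m) by rewrite A.
have {}B : (2 * b) * (m.+1 * m) = m.*2.+3 * m.+1.*2 * (m.+1 * m) by rewrite B.
rewrite expnS expn1; lia.
Qed.

Section Optimal.
Variables (m : nat) (u : nat -> nat -> bool).
Hypothesis cr_u : crossings m.*2.+1 u = Z m.*2.+1.

Lemma optimal_weight k : k < m -> weight u m.*2.+1 k = 3 * 'C(k.+2, 3).
Proof.
move=> km; have := crossings_weight u m; rewrite cr_u optimal_weight_value.
rewrite -sum_hockey big_distrr /= => /addnI /eqP; rewrite eqn_pmul2l // => /eqP E.
have ge (i : 'I_m) : true -> 3 * 'C(i.+2, 3) <= weight u m.*2.+1 i ?=
    iff (3 * 'C(i.+2, 3) == weight u m.*2.+1 i).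
  by move=> _; split => //; apply: weight_ge; have := ltn_ord i; lia.
have [_] := leqif_sum ge; rewrite E eqxx => /esym /forallP /(_ (Ordinal km)) /=.
by move/eqP.
Qed.

(** By [weightS], a minimal weight on 2m+1 vertices forces the total of the rows on 2m vertices down
    to its lower bound, and hence every single row. *)
Lemma optimal_low_row k a : k.+1 < m -> a < m.*2 ->
  low_row u m.*2 k a = k.+1 - a.
Proof.
move=> km am; have W1 := @optimal_weight k.+1 km.
rewrite weightS in W1; last lia.
have W3 : 3 * 'C(k.+2, 3) <= weight u m.*2 k by apply: weight_ge; lia.
rewrite (binS k.+2 2) in W1.
have ge (i : 'I_m.*2) : true -> k.+1 - i <= low_row u m.*2 k i ?=
    iff (k.+1 - i == low_row u m.*2 k i).
  by move=> _; split => //; apply: low_row_ge; lia.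
have [] := leqif_sum ge; rewrite sum_truncB; last lia.
move=> L; have -> : 'C(k.+2, 2) = \sum_(i < m.*2) low_row u m.*2 k i.
  by apply/eqP; rewrite eqn_leq L /=; move: (\sum_(i < _) _) W1; lia.
by rewrite eqxx => /esym /forallP /(_ (Ordinal am)) /eqP.
Qed.

End Optimal.

(** * Rotations of an optimal drawing *)

(** Vertex 0 moves to the end of the spine; a quadruple containing it keeps its two interleaving
    pairs, in exchanged order. *)
Lemma crossings_shift p u : (forall a b, u a b = u b a) ->
  (forall a b, u (a + p.+1) b = u a b) ->
  crossings p.+1 (fun a b => u a.+1 b.+1) = crossings p.+1 u.
Proof.
move=> sym_u per_u; rewrite /crossings sum4S sum4_shift addnC; congr (_ + _).
apply: eq_sum3 => a b c _ _ _.
by rewrite [u b.+1 _]sym_u -[p.+1]add0n per_u eq_sym.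
Qed.

Lemma crossings_rot p u r : (forall a b, u a b = u b a) ->
  (forall a b, u (a + p.+1) b = u a b) ->
  crossings p.+1 (fun a b => u (a + r) (b + r)) = crossings p.+1 u.
Proof.
move=> sym_u per_u; elim: r => [|r IHr].
  by apply: eq_sum4 => a b c d _ _ _ _; rewrite !addn0.
rewrite -IHr -[RHS]crossings_shift; first last.
- by move=> a b; rewrite addnAC per_u.
- by move=> a b; rewrite sym_u.
by apply: eq_sum4 => a b c d _ _ _ _; rewrite !addSnnS.
Qed.

Lemma size_le_low_row u s k a (xs : seq nat) : uniq xs ->
  all (fun b => (a < b < s) && (opp u s a b <= k)) xs ->
  size xs <= low_row u s k a.
Proof.
move=> uxs /allP sub; rewrite /low_row.
have -> : \sum_(a.+1 <= b < s) (opp u s a b <= k) =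
    size [seq b <- index_iota a.+1 s | opp u s a b <= k].
  by rewrite size_filter -sum1_count [RHS]big_mkcond; apply: eq_bigr => b _; case: leqP.
apply: uniq_leq_size => // b /sub /andP[abs bk].
by rewrite mem_filter mem_index_iota bk.
Qed.

Section Positions.
Variables (m : nat) (u : nat -> nat -> bool).
Hypotheses (m_gt3 : 3 < m) (cr_u : crossings m.*2.+1 u = Z m.*2.+1).

Lemma optimal_low_edges k a (xs : seq nat) : k < 3 -> a < 3 -> uniq xs ->
  all (fun b => (a < b < m.*2) && (opp u m.*2 a b <= k)) xs ->
  size xs <= k.+1 - a.
Proof.
move=> k3 a3 uxs /(size_le_low_row uxs); rewrite optimal_low_row //; lia.
Qed.

(** The chord joins positions 1 and [j.+1]. Optimality at vertex 2 allows no edge to a later vertex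
    before the last one with [opp] at most 1, and only one with [opp] at most 2. *)
Lemma no_separating_chord c j : 2 < j -> j.+1 < m.*2 ->
  (forall x, 2 < x -> x <= j -> u 0 x = c) ->
  (forall y, j.+1 < y -> y <= m.*2 -> u 2 y = c) -> False.
Proof.
move=> j_gt2 j_lt u0 u2.
have us : u 2 m.*2 = c by apply: u2; lia.
(* The maximal such [x] is the last inner vertex joined to 2 on the other page, or 3 if there is
   none. Only vertices 1 and [j.+1] can then count in [opp] of the edge 2x. *)
pose P x := (2 < x <= j) && ((x == 3) || (u 2 x != c)).
have exP : exists x, P x by exists 3; rewrite /P; lia.
have ubP x : P x -> x <= j by case/andP; lia.
case: (ex_maxnP exP ubP) => x /andP[/andP[x_gt2 xj] xP] maxx.
have head y : 2 < y -> y <= j ->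
    \sum_(k < 2) (u k y == ~~ u 2 m.*2) <= 1.
  move=> y2 yj; rewrite !big_ord_recl big_ord0 us u0 //.
  by case: (c) => /=; case: (u _ _).
have tail : \sum_(j.+2 <= k < m.*2) (u 2 k == ~~ u 2 m.*2) = 0.
  rewrite big_nat_cond big1 // => y /andP[/andP[jy ys] _].
  by rewrite us u2 ?eqb_negLR //; [case: (c) | lia].
have opp_x : opp u m.*2 2 x <= (u 2 j.+1 == ~~ u 2 m.*2).+1.
  rewrite /opp /side (@big_cat_nat _ _ _ j.+1) //=; [|lia..].
  rewrite (@big_ltn _ _ _ j.+1) ?tail //.
  have -> : \sum_(x.+1 <= k < j.+1) (u 2 k == ~~ u 2 m.*2) = 0.
    rewrite big_nat_cond big1 // => y /andP[/andP[xy yj] _].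
    have : ~~ P y by apply/negP => /maxx; lia.
    rewrite /P us; case: (u 2 y); case: (c) => //=; lia.
  have -> : (x - 3) * (u 2 x != ~~ u 2 m.*2) = 0.
    by move: xP; rewrite us => /orP[/eqP->//|]; case: (u 2 x); case: (c);
       rewrite ?muln0.
  by move: (\sum_(_ < 2) _) (head x x_gt2 xj); lia.
(* If [j.+1] counts, the edges from 2 to [x] and to [j.+1] both have [opp] at most 2; otherwise the
   edge to [x] has [opp] at most 1. *)
case uj : (u 2 j.+1 == ~~ u 2 m.*2) opp_x => opp_x.
  have opp_j : opp u m.*2 2 j.+1 <= 2.
    rewrite /opp /side tail (eqP uj) eqxx muln0 !big_ord_recl big_ord0.
    by case: (_ == _) => //=; case: (_ == _).
  have := @optimal_low_edges 2 2 [:: x; j.+1].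
  rewrite /= opp_x opp_j inE; lia.
have := @optimal_low_edges 1 2 [:: x]; rewrite /= opp_x; lia.
Qed.

(** If 03 were on page [c], both 12 and 13 would have [opp] at most 1, but vertex 1 allows only one
    such edge. With 03 on the other page, 23 has [opp] at most 1, which vertex 2 forbids. *)
Lemma no_adjacent_monochrome c :
  (forall y, 2 < y -> y <= m.*2 -> u 1 y = c) ->
  (forall y, 3 < y -> y <= m.*2 -> u 2 y = ~~ c) -> False.
Proof.
move=> u1 u2.
have u1s : u 1 m.*2 = c by apply: u1; lia.
have u2s : u 2 m.*2 = ~~ c by apply: u2; lia.
have u1k x : 1 < x -> \sum_(x.+1 <= k < m.*2) (u 1 k == ~~ u 1 m.*2) = 0.
  move=> x1; rewrite big_nat_cond big1 // => y /andP[/andP[jy ys] _].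
  by rewrite u1s u1; [case: (c) | lia..].
have u2k : \sum_(4 <= k < m.*2) (u 2 k == ~~ u 2 m.*2) = 0.
  rewrite big_nat_cond big1 // => y /andP[/andP[jy ys] _].
  by rewrite u2s u2; [case: (c) | lia..].
have u03 : u 0 3 = ~~ c.
  apply/eqP/negPn/negP => nu03.
  have := @optimal_low_edges 1 1 [:: 2; 3].
  rewrite /= /opp /side !u1k // !big_ord1 subnn mul0n.
  rewrite [u 0 3 == _](_ : _ = false); last first.
    by apply/negbTE; rewrite u1s.
  by have := leq_b1 (u 0 2 == ~~ u 1 m.*2); have := leq_b1 (u 1 3 != ~~ u 1 m.*2); lia.
have := @optimal_low_edges 1 2 [:: 3].
rewrite /= /opp /side u2k subnn mul0n !big_ord_recl big_ord0 /=.
rewrite [u 0 3 == _](_ : _ = false); last by rewrite u03 u2s; case: (c).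
by have := leq_b1 (u (bump 0 0) 3 == ~~ u 2 m.*2); lia.
Qed.

End Positions.

(** * Cyclic indexing of the vertices *)

Definition vtx p (a : nat) : 'I_p.+1 := inord (a %% p.+1).

Lemma vtxE p a : vtx p a = a %% p.+1 :> nat.
Proof. by rewrite inordK // ltn_pmod. Qed.

Lemma vtx_val p (x : 'I_p.+1) : vtx p x = x.
Proof. by apply: val_inj; rewrite /= vtxE modn_small. Qed.

Lemma eq_vtx p a b : (vtx p a = vtx p b) <-> (a = b %[mod p.+1]).
Proof.
split=> [/(congr1 val)|E]; first by rewrite /= !vtxE.
by apply: val_inj; rewrite /= !vtxE.
Qed.

Lemma vtxDn p a : vtx p (a + p.+1) = vtx p a.
Proof. by apply/eq_vtx; rewrite modnDr. Qed.

Lemma vtx_inj_add p a b k : vtx p (a + k) = vtx p (b + k) -> vtx p a = vtx p b.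
Proof. by move/eq_vtx/eqP; rewrite eqn_modDr => /eqP /eq_vtx. Qed.

Lemma vtx_add p (x : 'I_p.+1) k : k <= p ->
  vtx p (x + k) = (if x + k <= p then x + k else x + k - p.+1) :> nat.
Proof.
move=> kp; rewrite vtxE; case: leqP => [|xk]; first by move=> ?; rewrite modn_small.
by rewrite -{1}(subnK xk) modnDr modn_small //; have := ltn_ord x; lia.
Qed.

Definition sympage p (page : book_drawing p.+1) (x y : 'I_p.+1) :=
  if x < y then page x y else page y x.

Definition cycpage p (page : book_drawing p.+1) a b :=
  sympage page (vtx p a) (vtx p b).

Lemma sympageC p (page : book_drawing p.+1) x y :
  sympage page x y = sympage page y x.
Proof. by rewrite /sympage; case: ltngtP => // /val_inj ->. Qed.

Lemma cycpageC p (page : book_drawing p.+1) a b :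
  cycpage page a b = cycpage page b a.
Proof. exact: sympageC. Qed.

Lemma cycpageD p (page : book_drawing p.+1) a b :
  cycpage page (a + p.+1) b = cycpage page a b.
Proof. by rewrite /cycpage vtxDn. Qed.

Lemma edge_ofC n (x y : 'I_n) : edge_of x y = edge_of y x.
Proof. by rewrite /edge_of; case: ltngtP => // /val_inj ->. Qed.

Lemma sum_ord_ltn n k (F : nat -> nat) : k <= n ->
  \sum_(a < k) F a = \sum_(a < n) (a < k) * F a.
Proof.
move=> kn; rewrite (big_ord_widen n F kn) [LHS]big_mkcond /=.
by apply: eq_bigr => a _; case: ltnP; rewrite ?mul1n.
Qed.

Lemma crossing_numberE p (page : book_drawing p.+1) :
  crossing_number page = crossings p.+1 (cycpage page).
Proof.
rewrite /crossing_number -sum1dep_card big_mkcond /=.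
rewrite -(pair_bigA _ (fun (x : 'I_p.+1 * 'I_p.+1 * 'I_p.+1) (d : 'I_p.+1) =>
  if [&& x.1.1 < x.1.2, x.1.2 < x.2, x.2 < d &
  page x.1.1 x.2 == page x.1.2 d] then 1 else 0)) /=.
rewrite -(pair_bigA _ (fun (x : 'I_p.+1 * 'I_p.+1) (c : 'I_p.+1) =>
  \sum_(d < p.+1) if [&& x.1 < x.2, x.2 < c, c < d &
  page x.1 c == page x.2 d] then 1 else 0)) /=.
rewrite -(pair_bigA _ (fun a b : 'I_p.+1 =>
  \sum_(c < p.+1) \sum_(d < p.+1) if [&& a < b, b < c, c < d &
  page a c == page b d] then 1 else 0)) /=.
rewrite /crossings /sum4 /sum3 /sum2.
transitivity (\sum_(d < p.+1) \sum_(c < p.+1) \sum_(b < p.+1) \sum_(a < p.+1)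
  if [&& a < b, b < c, c < d & page a c == page b d] then 1 else 0).
  under eq_bigr => a _.
    under eq_bigr => b _ do rewrite exchange_big.
    rewrite exchange_big.
    over.
  rewrite exchange_big; apply: eq_bigr => d _.
  under eq_bigr => a _ do rewrite exchange_big.
  rewrite exchange_big; apply: eq_bigr => c _.
  by rewrite exchange_big.
apply: eq_bigr => d _.
rewrite (sum_ord_ltn (fun c => \sum_(b < c) \sum_(a < b)
  (cycpage page a c == cycpage page b d)) (ltnW (ltn_ord d))); apply: eq_bigr => c _.
case: (ltnP c d) => cd; last first.
  by rewrite mul0n big1 // => b _; rewrite big1 // => a _; rewrite !andbF.
rewrite mul1n.
rewrite (sum_ord_ltn (fun b => \sum_(a < b)
  (cycpage page a c == cycpage page b d)) (ltnW (ltn_ord c))); apply: eq_bigr => b _.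
case: (ltnP b c) => bc; last first.
  by rewrite mul0n big1 // => a _; rewrite !andbF.
rewrite mul1n.
rewrite (sum_ord_ltn (fun a => cycpage page a c == cycpage page b d)
  (ltnW (ltn_ord b))); apply: eq_bigr => a _.
case: (ltnP a b) => ab //; rewrite mul1n /= /cycpage !vtx_val /sympage.
by rewrite (ltn_trans ab bc) (ltn_trans bc cd); case: eqP.
Qed.

Lemma non_crossed_separated p (page : book_drawing p.+1) (x y z w : 'I_p.+1) :
  non_crossed page (edge_of x y) ->
  (minn x y < z < maxn x y) -> (w < minn x y) || (maxn x y < w) ->
  sympage page z w != sympage page x y.
Proof.
move=> /forallP nc zin wout; apply/negP => /eqP E.
have /forallP /(_ (if z < w then w else z)) := nc (if z < w then z else w).
move: E; rewrite /crosses /sympage /edge_of.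
by case: (ltnP z w) => zw; case: (ltnP x y) => xy /= -> /negP; apply;
  rewrite eqxx; lia.
Qed.

Lemma non_crossed_cyc p (page : book_drawing p.+1) r j k l :
  non_crossed page (edge_of (vtx p r) (vtx p (r + j))) ->
  0 < k -> k < j -> j < l -> l <= p ->
  cycpage page (r + k) (r + l) != cycpage page r (r + j).
Proof.
have D t : vtx p (r + t) = vtx p (vtx p r + t).
  by apply/eq_vtx; rewrite vtxE modnDml.
rewrite /cycpage !D; move: (vtx p r) => {D}x.
move=> nc k0 kj jl lp; have xp := ltn_ord x.
have Ej := @vtx_add p x j; have Ek := @vtx_add p x k; have El := @vtx_add p x l.
move: (vtx p (x + j)) (vtx p (x + k)) (vtx p (x + l)) Ej Ek El nc => y z w Ej Ek El nc.
have {}Ej : if x + j <= p then nat_of_ord y = x + j else y + p.+1 = x + j.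
  by rewrite Ej; [case: leqP; lia | lia].
have {}Ek : if x + k <= p then nat_of_ord z = x + k else z + p.+1 = x + k.
  by rewrite Ek; [case: leqP; lia | lia].
have {}El : if x + l <= p then nat_of_ord w = x + l else w + p.+1 = x + l.
  by rewrite El; [case: leqP; lia | lia].
move: Ej Ek El.
(* Whichever indices wrap around, [z] and [w] stay on different sides of the chord; only which of
   them lies inside the interval varies. *)
case: (leqP (x + j)) => ? Ej; case: (leqP (x + k)) => ? Ek;
  case: (leqP (x + l)) => ? El;
  (have [zin|zout] := boolP (minn x y < z < maxn x y);
    [|rewrite sympageC]; apply: (non_crossed_separated nc); lia).
Qed.

(** * Non-crossed edges of an optimal drawing *)

Section OptimalDrawing.
Variables (m : nat) (page : book_drawing m.*2.+1).
Hypotheses (m_gt3 : 3 < m) (opt : crossing_optimal page).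

Local Notation p := m.*2.
Local Notation vtx := (vtx p).

Lemma crossings_optimal_rot r :
  crossings p.+1 (fun a b => cycpage page (a + r) (b + r)) = Z p.+1.
Proof.
rewrite crossings_rot -?crossing_numberE //; first exact: cycpageC.
exact: cycpageD.
Qed.

Lemma non_crossed_length r j : 0 < j -> j <= p ->
  non_crossed page (edge_of (vtx r) (vtx (r + j))) ->
  [\/ j = 1, j = 2, j = p | j = p.-1].
Proof.
move=> j0 jp nc.
have [[j3 jp2]|] : (2 < j /\ j.+1 < p) \/ ~ (2 < j /\ j.+1 < p) by lia.
  exfalso; pose c := ~~ cycpage page r (r + j).
  (* Rotation by [r + p], that is by r-1 modulo [p.+1], puts the chord at positions 1 and [j.+1]. *)
  apply: (@no_separating_chord m _ m_gt3 (crossings_optimal_rot (r + p)) c j) => //.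
  - move=> x x2 xj; rewrite add0n cycpageC.
    have -> : x + (r + p) = (r + x.-1) + p.+1 by lia.
    rewrite cycpageD; have := @non_crossed_cyc p page r j x.-1 p nc.
    by rewrite /c; lia.
  - move=> y jy yp.
    have -> : 2 + (r + p) = (r + 1) + p.+1 by lia.
    have -> : y + (r + p) = (r + y.-1) + p.+1 by lia.
    rewrite cycpageD cycpageC cycpageD cycpageC.
    have := @non_crossed_cyc p page r j 1 y.-1 nc.
    by rewrite /c; lia.
by move=> H; have : j = 1 \/ j = 2 \/ j = p \/ j = p.-1 by [lia];
  case=> [|[|[|]]] ->; [apply: Or41|apply: Or42|apply: Or43|apply: Or44].
Qed.

Lemma no_crossing_ears r :
  non_crossed page (edge_of (vtx r) (vtx (r + 2))) ->
  non_crossed page (edge_of (vtx r.+1) (vtx (r.+1 + 2))) -> False.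
Proof.
move=> nc1 nc2; pose c := ~~ cycpage page r (r + 2).
have u1 y : 2 < y -> y <= p -> cycpage page (1 + r) (y + r) = c.
  move=> y2 yp; have := @non_crossed_cyc p page r 2 1 y nc1.
  by rewrite /c ![r + _]addnC; lia.
apply: (@no_adjacent_monochrome m _ m_gt3 (crossings_optimal_rot r) c) => //.
(* The second chord is itself an edge at r+1, hence lies on page [c], and so forces the edges that
   leave r+2 across it onto the other page. *)
move=> y y3 yp; rewrite -(u1 3) //; last lia.
have := @non_crossed_cyc p page r.+1 2 1 y.-1 nc2.
have -> : r.+1 + 1 = 2 + r by lia.
have -> : r.+1 + 2 = 3 + r by lia.
have -> : r.+1 + y.-1 = y + r by lia.
by rewrite add1n; lia.
Qed.

(** The base point [r.+2] lets the vertices at cyclic distance 1 and 2 be written without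
    subtraction. *)
Lemma non_crossed_neighbour r y :
  y != vtx r.+2 -> non_crossed page (edge_of (vtx r.+2) y) ->
  y \in [:: vtx r; vtx r.+1; vtx r.+3; vtx r.+4].
Proof.
move=> neq nc; pose j := (y + p.+1 - vtx r.+2) %% p.+1.
have Ey : y = vtx (r.+2 + j).
  apply: val_inj; rewrite /= vtxE /j modnDmr.
  rewrite -modnDml -[r.+2 %% _]vtxE subnKC ?modnDr ?modn_small //.
  by have := ltn_ord (vtx r.+2); lia.
have j0 : 0 < j.
  by rewrite lt0n; apply/eqP => j0; rewrite Ey j0 addn0 eqxx in neq.
rewrite Ey in nc *; have := non_crossed_length j0 _ nc.
have jp : j <= p by rewrite -ltnS ltn_pmod.
move=> /(_ jp)[] ->; rewrite !inE.
- by rewrite addn1 eqxx !orbT.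
- by rewrite addn2 eqxx !orbT.
- have -> : r.+2 + p = r.+1 + p.+1 by lia.
  by rewrite vtxDn eqxx !orbT.
- have -> : r.+2 + p.-1 = r + p.+1 by lia.
  by rewrite vtxDn eqxx.
Qed.

End OptimalDrawing.

(** * Hamiltonian cycles *)

Section Cycles.
Variables (p : nat) (s : seq 'I_p.+1).
Hypotheses (uniq_s : uniq s) (size_s : size s = p.+1) (p_gt1 : 1 < p).

Local Notation vtx := (vtx p).
Local Notation pos i := (nth ord0 s (i %% p.+1)).

Lemma cycle_edgesP e :
  reflect (exists i, e = edge_of (pos i) (pos i.+1)) (e \in cycle_edges s).
Proof.
rewrite inE; apply: (iffP existsP) => [[i /eqP ->]|[i ->]].
  exists i; rewrite !(tnth_nth ord0) /=.
  have ip : i < p.+1 by apply: leq_trans (ltn_ord i) _; rewrite size_s.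
  by rewrite (modn_small ip); move: (nat_of_ord i) => k; rewrite size_s.
have ip : i %% p.+1 < size s by rewrite size_s ltn_pmod.
exists (Ordinal ip); rewrite !(tnth_nth ord0) /= size_s.
by rewrite -[(i %% _).+1]addn1 modnDml addn1.
Qed.

(** The successor form of the index gives access to both cycle neighbours of [v], [pos i] and
    [pos i.+2]. *)
Lemma pos_surj v : exists i, v = pos i.+1.
Proof.
have vs : v \in s.
  have sub : {subset s <= enum 'I_p.+1} by move=> x _; rewrite mem_enum.
  have [|_ ->] := uniq_min_size uniq_s sub; last by rewrite mem_enum.
  by rewrite size_enum_ord size_s.
exists (index v s + p); rewrite -addnS modnDr modn_small ?nth_index //.
by have := index_mem v s; rewrite size_s vs.
Qed.

Lemma pos_inj i j : pos i = pos j -> i = j %[mod p.+1].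
Proof.
by move=> E; apply/eqP; rewrite -(nth_uniq ord0 _ _ uniq_s) ?size_s ?ltn_pmod ?E.
Qed.

Lemma pos_neq i k : 0 < k -> k <= p -> pos (i + k) <> pos i.
Proof.
move=> k0 kp /pos_inj /eqP; rewrite -[in X in _ == X %[mod _]](addn0 i).
by rewrite eqn_modDl mod0n modn_small //; lia.
Qed.

Lemma std_edge_of a : edge_of (vtx a) (vtx a.+1) \in std_cycle_edges p.+1.
Proof.
have E : vtx a.+1 = vtx (vtx a + 1) by apply/eq_vtx; rewrite vtxE modnDml addn1.
rewrite E; move: (vtx a) => x; have xp := ltn_ord x.
have : x < p /\ vtx (x + 1) = x.+1 :> nat \/ x = p :> nat /\ vtx (x + 1) = 0 :> nat.
  by rewrite vtx_add; [case: (leqP (x + 1) p); lia | lia].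
by move: (vtx _) => y H; rewrite inE /edge_of; case: (ltnP x y) => /= ?; lia.
Qed.

Lemma std_edgeP e : e \in std_cycle_edges p.+1 ->
  exists a, e = edge_of (vtx a.+1) (vtx a.+2).
Proof.
rewrite inE; case: e => x y /= /andP[xy]; case/orP => [/eqP E|/andP[/eqP Ex /eqP Ey]].
  exists (x + p); have -> : (x + p).+2 = x.+1 + p.+1 by lia.
  rewrite -addnS !vtxDn vtx_val -E vtx_val.
  by rewrite /edge_of xy.
exists p.-1; have -> : p.-1.+1 = p by lia.
have -> : vtx p = y by apply: val_inj; rewrite /= vtxE modn_small ?Ey.
have -> : vtx p.+1 = x by apply: val_inj; rewrite /= vtxE modnn Ex.
by rewrite /edge_of; case: ltngtP xy.
Qed.

Definition adjacent (x y : 'I_p.+1) := (y == vtx x.+1) || (x == vtx y.+1).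

Lemma adjacentP x a : adjacent x (vtx a.+1) -> x = vtx a \/ x = vtx a.+2.
Proof.
have S (y : 'I_p.+1) b : vtx b = y -> vtx b.+1 = vtx y.+1.
  by move=> <-; apply/eq_vtx; rewrite -[in RHS]addn1 vtxE modnDml addn1.
case/orP => [/eqP E|/eqP ->]; [left | right].
  by rewrite -[x]vtx_val; apply: (@vtx_inj_add p _ _ 1); rewrite !addn1.
by rewrite (S (vtx a.+1) a.+1).
Qed.

(** The two cycle neighbours of a vertex are distinct, so they are its two circular neighbours, and
    every standard edge occurs. *)
Lemma cycle_edges_std : (forall i, adjacent (pos i) (pos i.+1)) ->
  cycle_edges s = std_cycle_edges p.+1.
Proof.
move=> adj; apply/setP => e; apply/idP/idP => [/cycle_edgesP[i ->]|].
  by case/orP: (adj i) => /eqP ->; [|rewrite edge_ofC];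
    rewrite -{1}[pos _]vtx_val std_edge_of.
move=> /std_edgeP[a ->]; have [i Ei] := pos_surj (vtx a.+1).
have adjC x y : adjacent x y = adjacent y x by rewrite /adjacent orbC.
have := adj i; have := adj i.+1; rewrite adjC -Ei.
case/adjacentP => E2; last by move=> _; apply/cycle_edgesP; exists i.+1; rewrite E2 Ei.
case/adjacentP => E0; last by apply/cycle_edgesP; exists i; rewrite edge_ofC E0 Ei.
by case: (@pos_neq i 2) => //; rewrite addn2 E0 E2.
Qed.

End Cycles.

Section OptimalHamiltonCycle.
Variables (m : nat) (page : book_drawing m.*2.+1) (s : seq 'I_m.*2.+1).
Hypotheses (m_gt3 : 3 < m) (opt : crossing_optimal page).
Hypothesis ham : noncrossed_ham_cycle page s.

Local Notation p := m.*2.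
Local Notation vtx := (vtx p).
Local Notation pos i := (nth ord0 s (i %% p.+1)).

Let uniq_s : uniq s. Proof. by case: ham. Qed.
Let size_s : size s = p.+1. Proof. by case: ham. Qed.

Lemma ham_non_crossed i : non_crossed page (edge_of (pos i) (pos i.+1)).
Proof. by case: ham => _ _; apply; apply/(cycle_edgesP size_s); exists i. Qed.

Lemma ham_neq i : pos i.+1 != pos i.
Proof. by apply/eqP; rewrite -[i.+1]addn1; apply: pos_neq => //; lia. Qed.

(* A chord of the cycle that cuts off only the vertex v := t+1 leaves v with
   neighbours t and t+2, closing a triangle, or with a second chord that cuts
   off t or t+2 and crosses the first one. *)
Lemma ham_no_ear t i :
  ~ (pos i = vtx t /\ pos i.+1 = vtx t.+2 \/ pos i = vtx t.+2 /\ pos i.+1 = vtx t).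
Proof.
move=> ear; have nct : non_crossed page (edge_of (vtx t) (vtx (t + 2))).
  have := ham_non_crossed i; rewrite addn2.
  by case: ear => -[-> ->] //; rewrite edge_ofC.
(* Here [t + p] stands for t-1, so the neighbour candidates of t+1 become t-1, t, t+2 and t+3. *)
have E1 : vtx (t + p).+1 = vtx t by rewrite -addnS vtxDn.
have E2 : vtx (t + p).+2 = vtx t.+1 by rewrite -[RHS]vtxDn addnS.
have E3 : vtx (t + p).+3 = vtx t.+2 by rewrite -[RHS]vtxDn addnS.
have E4 : vtx (t + p).+4 = vtx t.+3 by rewrite -[RHS]vtxDn addnS.
have [k Ek] := pos_surj uniq_s size_s (vtx t.+1).
have ctr y : y != vtx t.+1 -> non_crossed page (edge_of (vtx t.+1) y) ->
    y = vtx t \/ y = vtx t.+2.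
  move=> neq nc; have := @non_crossed_neighbour m page m_gt3 opt (t + p) y.
  rewrite E1 E2 E3 E4 => /(_ neq nc).
  rewrite !inE => /or4P[]/eqP Ey; [|by left|by right|].
  - case: (@no_crossing_ears m page m_gt3 opt (t + p)).
      by rewrite addn2 E2 edge_ofC -Ey.
    by rewrite addn2 E1 E3 -addn2.
  - case: (@no_crossing_ears m page m_gt3 opt t) => //.
    by rewrite addn2 -Ey.
have nck := ham_non_crossed k; have nck1 := ham_non_crossed k.+1.
have nek := ham_neq k; have nek1 := ham_neq k.+1.
rewrite -Ek in nck nck1 nek nek1.
have D1 : pos k = vtx t \/ pos k = vtx t.+2.
  by apply: ctr; rewrite 1?eq_sym // edge_ofC.
have D2 := ctr _ nek1 nck1.
have neq2 : pos k.+2 <> pos k by rewrite -[k.+2]addn2; apply: pos_neq => //; lia.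
(* The cycle neighbours of t+1 are the two ends of the edge at position [i]. Comparing positions
   gives 2 = 1 or 3 = 0 modulo [p.+1]. *)
have P : (pos k = pos i /\ pos k.+2 = pos i.+1) \/
         (pos k = pos i.+1 /\ pos k.+2 = pos i).
  by case: ear D1 D2 neq2 => -[-> ->] [->|->] [->|->]; tauto.
case: P => -[/(pos_inj uniq_s size_s) Pk /(pos_inj uniq_s size_s) Pk2].
  move: Pk2; rewrite -[k.+2]addn2 -modnDml Pk modnDml -[i.+1]addn1 => /eqP.
  by rewrite eqn_modDl !modn_small //; lia.
move: Pk2; rewrite -[k.+2]addn2 -modnDml Pk modnDml addSnnS.
rewrite -[in RHS](addn0 i) => /eqP.
by rewrite eqn_modDl !modn_small //; lia.
Qed.

Lemma ham_adjacent i : adjacent (pos i) (pos i.+1).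
Proof.
have [r Er] : exists r, pos i = vtx r.+2.
  exists (pos i + p.-1); rewrite (_ : _.+2 = pos i + p.+1); last lia.
  by rewrite vtxDn vtx_val.
have := @non_crossed_neighbour m page m_gt3 opt r (pos i.+1).
rewrite -Er => /(_ (ham_neq i) (ham_non_crossed i)).
have S a : vtx (vtx a).+1 = vtx a.+1.
  by apply/eq_vtx; rewrite -addn1 vtxE modnDml addn1.
rewrite !inE => /or4P[]/eqP E.
- by case: (@ham_no_ear r i); right.
- by rewrite /adjacent E Er !S eqxx orbT.
- by rewrite /adjacent E Er S eqxx.
- by case: (@ham_no_ear r.+2 i); left.
Qed.

End OptimalHamiltonCycle.

(** No vertex lies strictly between two consecutive ones, and none lies outside the interval from
    the first to the last. *)
Lemma std_edge_non_crossed n (page : book_drawing n) e :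
  e \in std_cycle_edges n -> non_crossed page e.
Proof.
rewrite inE; case: e => x y /= H.
apply/forallP => c; apply/forallP => d; rewrite /crosses /=.
by have := ltn_ord d; move: (page x y == _) => b; lia.
Qed.

Lemma enum_cycle_edges p : 1 < p ->
  cycle_edges (enum 'I_p.+1) = std_cycle_edges p.+1.
Proof.
move=> p1; apply: cycle_edges_std; rewrite ?enum_uniq ?size_enum_ord // => i.
have E k : nth ord0 (enum 'I_p.+1) (k %% p.+1) = vtx p k.
  by apply: val_inj; rewrite /= nth_enum_ord ?ltn_pmod // vtxE.
rewrite !E /adjacent (_ : vtx p (vtx p i).+1 = vtx p i.+1) ?eqxx //.
by apply/eq_vtx; rewrite -addn1 vtxE modnDml addn1.
Qed.

Theorem theorem21 (n : nat) (page : book_drawing n) :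
  odd n -> 13 <= n -> normalized page -> crossing_optimal page ->
  (forall s : seq 'I_n, noncrossed_ham_cycle page s ->
     cycle_edges s = std_cycle_edges n) /\
  (exists s : seq 'I_n, noncrossed_ham_cycle page s /\
     cycle_edges s = std_cycle_edges n).
Proof.
move=> odd_n n_ge13 _; have Dn : n = n./2.*2.+1 by lia.
move: page; rewrite Dn; have : 3 < n./2 by lia.
move: (n./2) => m m_gt3 page opt; split=> [s ham|].
  have [uniq_s size_s _] := ham.
  apply: cycle_edges_std => //; first lia.
  exact: ham_adjacent m_gt3 opt ham.
have E : cycle_edges (enum 'I_m.*2.+1) = std_cycle_edges m.*2.+1.
  by apply: enum_cycle_edges; lia.
exists (enum 'I_m.*2.+1); split=> //; split.
- exact: enum_uniq.
- exact: size_enum_ord.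
- by rewrite E; exact: std_edge_non_crossed.
Qed.
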